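(* Let $K$ be a field, $S=K[x_1,\ldots,x_n]$, $I\subset S$ a monomial ideal generated in degree $d$, and $B=G(I)$ its minimal set of monomial generators. Let $<^{\#}$ be a monomial order on $R=K[\{T_u\}_{u\in B}]$ and $<_\sigma$ a monomial order on $S$. Let $G_{<^{\#}}(J_{K[B]})$ be the reduced Gröbner basis of the toric ideal $J_{K[B]}$ with respect to $<^{\#}$. Suppose that $B$ satisfies the $\sigma$-exchange property with respect to $<^{\#}$. Then the reduced Gröbner basis of the toric ideal $P_{\mathcal R(I)}$ of the Rees ring of $I$ with respect to the product order $<_\sigma^{\#}$ consists of all binomials belonging to $G_{<^{\#}}(J_{K[B]})$ together with the binomials of the form $$x_iT_u-x_jT_v\in P_{\mathcal R(I)}\qquad (u,v\in B),$$ where $x_j$ is the smallest variable with respect to $<_\sigma$ such that $x_i>_\sigma x_j$ and $x_iu/x_j\in B$.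
   Context: For a monomial $w$ of $S$, $\nu_i(w)$ is the exponent of $x_i$ in $w$ and $\operatorname{supp}(w)=\{i:\nu_i(w)>0\}$. $K[B]\subset S$ is the $K$-subalgebra generated by the monomials in $B$, and the toric ideal $J_{K[B]}$ is the kernel of the $K$-algebra map $R\to K[B]$, $T_u\mapsto u$. A monomial of $R$ is a standard monomial of $J_{K[B]}$ with respect to $<^{\#}$ if it does not belong to the initial ideal $\mathrm{in}_{<^{\#}}(J_{K[B]})$. $B$ satisfies the $\sigma$-exchange property with respect to $<^{\#}$ if: whenever $T_{u_1}\cdots T_{u_N}$ and $T_{v_1}\cdots T_{v_N}$ are standard monomials of $J_{K[B]}$ with respect to $<^{\#}$ such that $u_1\cdots u_N<_\sigma v_1\cdots v_N$, there exist $1\le\delta\le N$, $q\in\operatorname{supp}(v_1\cdots v_N)$ and $j\in\operatorname{supp}(u_\delta)$ such that (i) $\nu_q(u_1\cdots u_N)<\nu_q(v_1\cdots v_N)$; (ii) $x_j<_\sigma x_q$; (iii) $x_qu_\delta/x_j\in B$. Let $\mathcal T=K[x_1,\ldots,x_n,T_u: u\in B]$ and $\mathcal R(I)=\bigoplus_{j\ge 0}I^jt^j\subset S[t]$ the Rees ring. $P_{\mathcal R(I)}$ is the kernel of the $K$-algebra map $\mathcal T\to\mathcal R(I)$, $x_i\mapsto x_i$, $T_u\mapsto ut$. The product order $<_\sigma^{\#}$ on $\mathcal T$ is defined, for monomials $m,m'$ of $S$ and $\tau,\tau'$ of $R$, by $m\tau<_\sigma^{\#}m'\tau'$ if $m<_\sigma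 m'$, or $m=m'$ and $\tau<^{\#}\tau'$.
   Formalization: The degree d is assumed positive: for d = 0 and I = S one has B = {1}, J_{K[B]} = (T_1 − 1) but P_{R(I)} = 0, so the claim as stated fails; no case in which it holds is lost. *)

(* Defs.v *)
From HB Require Import structures.
From mathcomp Require Import all_boot all_order all_algebra.
From mathcomp Require Import freeg mpoly.

Set Implicit Arguments.
Unset Strict Implicit.
Unset Printing Implicit Defensive.

Import GRing.Theory.
Local Open Scope ring_scope.

Section MonomialOrders.
Variable n : nat.

(* [lt] is the strict order. *)
Record monomial_order (lt : rel 'X_{1..n}) : Prop := MonomialOrder {
  mo_irr : irreflexive lt;
  mo_trans : transitive lt;
  mo_total : forall m1 m2, m1 != m2 -> lt m1 m2 || lt m2 m1;
  mo_gt0 : forall m, m != 0%MM -> lt 0%MM m;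
  mo_add : forall m m1 m2, lt m1 m2 -> lt (m1 + m)%MM (m2 + m)%MM
}.

End MonomialOrders.

Section GroebnerBases.
Variables (K : fieldType) (n : nat).
Implicit Types (A G J : {mpoly K[n]} -> Prop) (lt : rel 'X_{1..n}).

Definition ideal_gen A : {mpoly K[n]} -> Prop := fun p =>
  exists s : seq ({mpoly K[n]} * {mpoly K[n]}),
    (forall cf, cf \in s -> A cf.2) /\ p = \sum_(cf <- s) cf.1 * cf.2.

Definition initial_monomial lt (p : {mpoly K[n]}) (m : 'X_{1..n}) : Prop :=
  m \in msupp p /\ forall m', m' \in msupp p -> m' != m -> lt m' m.

(* The zero polynomial has no initial monomial. *)
Definition initial_ideal lt A : {mpoly K[n]} -> Prop :=
  ideal_gen (fun q => exists f m,
    [/\ A f, initial_monomial lt f m & q = 'X_[m]]).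

Definition standard_monomial lt J (m : 'X_{1..n}) : Prop :=
  ~ initial_ideal lt J 'X_[m].

Definition finite_subset A : Prop :=
  exists s : seq {mpoly K[n]}, forall p, A p <-> p \in s.

Definition groebner_basis lt J G : Prop :=
  [/\ finite_subset G,
      (forall g, G g -> J g /\ g != 0) &
      (forall p, initial_ideal lt J p <-> initial_ideal lt G p)].

Definition reduced_groebner_basis lt J G : Prop :=
  [/\ groebner_basis lt J G,
      (forall g m, G g -> initial_monomial lt g m -> g@_m = 1) &
      (forall f g mf m, G f -> G g -> f != g ->
         initial_monomial lt f mf -> m \in msupp g -> ~~ (mf <= m)%MM)].

Definition binomial_poly (f : {mpoly K[n]}) : Prop :=
  exists m m' : 'X_{1..n}, m != m' /\ f = 'X_[m] - 'X_[m'].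

End GroebnerBases.

Section MonomialIdeals.
Variables (K : fieldType) (n : nat).
Implicit Types (I : {mpoly K[n]} -> Prop) (M : 'X_{1..n} -> Prop).

Definition monomials_generate M I : Prop :=
  forall p, I p <-> ideal_gen (fun q => exists2 m, M m & q = 'X_[m]) p.

Definition monomial_ideal_generated_in_degree (d : nat) I : Prop :=
  exists2 M, (forall m, M m -> mdeg m = d) & monomials_generate M I.

(* Minimal with respect to inclusion; a monomial ideal has exactly one such
   set of generators, and it is finite. *)
Definition minimal_monomial_generators M I : Prop :=
  monomials_generate M I /\
  forall M' : 'X_{1..n} -> Prop, (forall m, M' m -> M m) ->
    monomials_generate M' I -> forall m, M m -> M' m.

End MonomialIdeals.

Section FiberAndReesRings.
Variables (K : fieldType) (n b : nat).

(* A finite set of monomials of S = K[x_1, .., x_n] is given by a duplicate-free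
   enumeration B.  The variable T_u of R = K[T_u : u in B] is 'X_k with
   u = tnth B k, so R = {mpoly K[b]}. *)
Variable B : b.-tuple 'X_{1..n}.

(* Kernel of R -> K[B], T_u |-> u; as K[B] is a subring of S, the kernel is
   taken in S. *)
Definition toric_ideal : {mpoly K[b]} -> Prop := fun p =>
  mmap (@mpolyC n K) (fun k => 'X_[tnth B k]) p = 0.

(* In K[x_1, .., x_n, T_u : u in B] = {mpoly K[n + b]} the x-variables come
   first. *)
Definition xvar (i : 'I_n) : {mpoly K[n + b]} := 'X_(lshift b i).
Definition Tvar (k : 'I_b) : {mpoly K[n + b]} := 'X_(rshift n k).

Definition R_in_T (p : {mpoly K[b]}) : {mpoly K[n + b]} :=
  mmap (@mpolyC (n + b) K) Tvar p.

Definition rees_var (i : 'I_(n + b)) : {poly {mpoly K[n]}} :=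
  match split i with
  | inl j => ('X_j : {mpoly K[n]})%:P
  | inr k => ('X_[tnth B k] : {mpoly K[n]})%:P * 'X
  end.

(* Kernel of x_i |-> x_i, T_u |-> u t; as the Rees ring is a subring of S[t],
   the kernel is taken in S[t]. *)
Definition rees_toric_ideal : {mpoly K[n + b]} -> Prop := fun p =>
  mmap (polyC \o @mpolyC n K) rees_var p = 0.

Definition xpart (m : 'X_{1..n + b}) : 'X_{1..n} :=
  [multinom m (lshift b i) | i < n].
Definition Tpart (m : 'X_{1..n + b}) : 'X_{1..b} :=
  [multinom m (rshift n k) | k < b].

Definition product_order (ltS : rel 'X_{1..n}) (ltR : rel 'X_{1..b}) :
    rel 'X_{1..n + b} := fun m m' =>
  ltS (xpart m) (xpart m') ||
  (xpart m == xpart m') && ltR (Tpart m) (Tpart m').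

(* x_i u / x_j is a monomial and belongs to B; [mnm_sub] is truncated, hence
   the divisibility condition. *)
Definition exchange_in (u : 'X_{1..n}) (i j : 'I_n) : bool :=
  (U_(j) <= U_(i) + u)%MM && ((U_(i) + u - U_(j))%MM \in B).

Definition sigma_exchange (ltS : rel 'X_{1..n}) (ltR : rel 'X_{1..b}) : Prop :=
  forall (N : nat) (u v : 'I_N -> 'I_b),
  let prodB (w : 'I_N -> 'I_b) := (\sum_(e < N) tnth B (w e))%MM in
  standard_monomial ltR toric_ideal (\sum_(e < N) U_(u e))%MM ->
  standard_monomial ltR toric_ideal (\sum_(e < N) U_(v e))%MM ->
  ltS (prodB u) (prodB v) ->
  exists (delta : 'I_N) (q j : 'I_n),
    [/\ (0 < prodB v q)%N,
        (0 < tnth B (u delta) j)%N,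
        (prodB u q < prodB v q)%N,
        ltS U_(j)%MM U_(q)%MM &
        exchange_in (tnth B (u delta)) q j].

Definition smallest_exchange (ltS : rel 'X_{1..n}) (u : 'X_{1..n})
    (i j : 'I_n) : Prop :=
  [/\ ltS U_(j)%MM U_(i)%MM, exchange_in u i j &
      forall j', ltS U_(j')%MM U_(i)%MM -> exchange_in u i j' -> j' != j ->
        ltS U_(j)%MM U_(j')%MM].

Definition exchange_binomial (ltS : rel 'X_{1..n}) (g : {mpoly K[n + b]}) :
    Prop :=
  exists (i j : 'I_n) (k l : 'I_b),
    [/\ g = xvar i * Tvar k - xvar j * Tvar l, rees_toric_ideal g &
        smallest_exchange ltS (tnth B k) i j].

End FiberAndReesRings.

Arguments toric_ideal K {n b} B p.
Arguments rees_toric_ideal K {n b} B p.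
Arguments sigma_exchange K {n b} B ltS ltR.

(* Main.v *)
Require Import Defs.
From HB Require Import structures.
From mathcomp Require Import all_boot all_order all_algebra.
From mathcomp Require Import freeg mpoly.
From Stdlib Require Import Classical.

Set Implicit Arguments.
Unset Strict Implicit.
Unset Printing Implicit Defensive.

Import GRing.Theory.
Local Open Scope ring_scope.

(* Write u^a for the image in S of a monomial T^a of R.  An element of a kernel
   of a monomial map contains, with each monomial, a second one having the same
   image; hence the standard monomials of J are the least elements of the fibers
   of T^a |-> u^a, and every element of G is a binomial.
   Let x^c T^a be the initial monomial of an element of the Rees ideal, with T^a
   standard, and let x^c' T^a' be a second monomial with the same image.  The
   fibers being finite, T^a' may be replaced by the standard monomial of its
   fiber.  Then c' < c, so u^a < u^a' by cancellation, and the exchange property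
   gives a variable x_q with higher exponent in u^a' than in u^a, hence dividing
   x^c, and a factor T_u of T^a such that x_q T_u is the initial monomial of an
   exchange binomial. *)

(** * Monomial orders *)

Lemma mo_asym n (lt : rel 'X_{1..n}) m1 m2 :
  monomial_order lt -> lt m1 m2 -> ~~ lt m2 m1.
Proof.
move=> mo lt12; apply/negP => lt21.
by have := mo_trans mo lt12 lt21; rewrite (mo_irr mo).
Qed.

Lemma mo_neq n (lt : rel 'X_{1..n}) m1 m2 :
  monomial_order lt -> lt m1 m2 -> m1 != m2.
Proof. by move=> mo; case: eqVneq => // ->; rewrite (mo_irr mo). Qed.

(** A proper divisor is smaller: the quotient exceeds 1, and multiplying by [m1] preserves this. *)
Lemma mo_lem n (lt : rel 'X_{1..n}) m1 m2 :
  monomial_order lt -> (m1 <= m2)%MM -> ~~ lt m2 m1.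
Proof.
move=> mo le12; have [<-|ne] := eqVneq m1 m2; first by rewrite (mo_irr mo).
apply: mo_asym => //; rewrite -(submK le12) -[X in lt X]add0m.
apply/mo_add/mo_gt0 => //; apply: contra_neq ne => sub0.
by rewrite -(submK le12) sub0 add0m.
Qed.

Lemma mo_addI n (lt : rel 'X_{1..n}) m m1 m2 :
  monomial_order lt -> lt (m1 + m)%MM (m2 + m)%MM -> lt m1 m2.
Proof.
move=> mo lt12; have [eq12|ne] := eqVneq m1 m2.
  by rewrite eq12 (mo_irr mo) in lt12.
case/orP: (mo_total mo ne) => // /(mo_add mo m)/(mo_trans mo lt12).
by rewrite (mo_irr mo).
Qed.

(** Applied to two finite sets: the fiber of a monomial of R, and the variables available for an
    exchange. *)
Lemma mo_min n (lt : rel 'X_{1..n}) (s : seq 'X_{1..n}) x :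
  monomial_order lt -> x \in s ->
  exists2 y, y \in s & forall z, z \in s -> z != y -> lt y z.
Proof.
move=> mo; elim: s x => // a s IHs x _.
case: s IHs => [_|b s IHs].
  by exists a => [|z]; rewrite ?mem_head // inE => /eqP ->; rewrite eqxx.
have [y ys miny] := IHs b (mem_head _ _).
have [eqay|ne] := eqVneq a y.
  by exists y => [|z]; rewrite inE ?ys ?orbT // eqay => /predU1P[->|/miny //];
     rewrite eqxx.
case/orP: (mo_total mo ne) => [ltay|ltya].
  exists a; rewrite ?mem_head // => z; rewrite inE => /predU1P[->|zs _].
    by rewrite eqxx.
  by have [->//|/(miny _ zs)/(mo_trans mo ltay)] := eqVneq z y.
exists y => [|z]; first by rewrite inE ys orbT.
by rewrite inE => /predU1P[->//|/miny].
Qed.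

(** * Generated ideals, initial ideals and initial monomials *)

Lemma ideal_genD (K : fieldType) n (A : {mpoly K[n]} -> Prop) p q :
  ideal_gen A p -> ideal_gen A q -> ideal_gen A (p + q).
Proof.
case=> [s [As ->]] [t [At ->]]; exists (s ++ t); split; last by rewrite big_cat.
by move=> cf; rewrite mem_cat => /orP[/As|/At].
Qed.

Lemma ideal_genM (K : fieldType) n (A : {mpoly K[n]} -> Prop) c p :
  ideal_gen A p -> ideal_gen A (c * p).
Proof.
case=> [s [As ->]]; exists [seq (c * cf.1, cf.2) | cf <- s]; split.
  by move=> _ /mapP[cf /As Acf ->].
by rewrite big_map mulr_sumr; apply: eq_bigr => cf _; rewrite mulrA.
Qed.

Lemma ideal_gen_sub (K : fieldType) n (A A' : {mpoly K[n]} -> Prop) p :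
  (forall q, A q -> ideal_gen A' q) -> ideal_gen A p -> ideal_gen A' p.
Proof.
move=> sAA' [s [As ->]]; elim: s As => [_|cf s IHs As].
  by rewrite big_nil; exists [::]; rewrite big_nil.
rewrite big_cons; apply: ideal_genD.
  by apply/ideal_genM/sAA'/As; rewrite mem_head.
by apply: IHs => x xs; apply: As; rewrite inE xs orbT.
Qed.

(** A monomial of a sum occurs in one of the summands, and each summand is a multiple of some
    generator. *)
Lemma mem_ideal_genX (K : fieldType) n (M : 'X_{1..n} -> Prop) p m :
  ideal_gen (fun q : {mpoly K[n]} => exists2 m, M m & q = 'X_[m]) p ->
  m \in msupp p -> exists2 m0, M m0 & (m0 <= m)%MM.
Proof.
case=> [s [Ms ->]] /msupp_sum_le/flattenP[t /mapP[cf]].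
rewrite mem_filter /= => cfs -> {t}.
have [m0 Mm0 ->] := Ms _ cfs.
rewrite (perm_mem (msuppMX _ _)) => /mapP[m1 _ ->].
by exists m0; rewrite ?lem_addr ?lem_addl.
Qed.

Lemma ideal_genX (K : fieldType) n (A : {mpoly K[n]} -> Prop) m0 m :
  A 'X_[m0] -> (m0 <= m)%MM -> ideal_gen A 'X_[m].
Proof.
move=> Am0 le; exists [:: ('X_[(m - m0)], 'X_[m0])]; split.
  by move=> cf; rewrite inE => /eqP ->.
by rewrite big_seq1 -mpolyXD submK.
Qed.

(** Turns membership in an initial ideal into divisibility, the ideal being generated by
    monomials. *)
Lemma initial_idealXP (K : fieldType) n lt (A : {mpoly K[n]} -> Prop) m :
  initial_ideal lt A 'X_[m] <->
  exists f m0, [/\ A f, initial_monomial lt f m0 & (m0 <= m)%MM].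
Proof.
split=> [inm|[f [m0 [Af f0 le]]]]; last first.
  by apply: (ideal_genX _ le); exists f, m0.
pose M m0 := exists2 f, A f & initial_monomial lt f m0.
have [||m0 [f Af f0] le] := @mem_ideal_genX K n M 'X_[m] m.
- apply: ideal_gen_sub inm => q [f [m0 [Af f0 ->]]].
  by apply: (@ideal_genX _ _ _ m0); rewrite ?lepm_refl //; exists m0 => //; exists f.
- by rewrite msuppX mem_head.
by exists f, m0.
Qed.

Lemma initial_uniq (K : fieldType) n lt (f : {mpoly K[n]}) m1 m2 :
  monomial_order lt ->
  initial_monomial lt f m1 -> initial_monomial lt f m2 -> m1 = m2.
Proof.
move=> mo [s1 max1] [s2 max2]; have [//|ne] := eqVneq m1 m2.
have := mo_asym mo (max2 _ s1 ne).
by rewrite max1 // eq_sym.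
Qed.

Lemma mem_msupp_binomial (K : fieldType) n (m1 m2 m : 'X_{1..n}) :
  m \in msupp ('X_[m1] - 'X_[m2] : {mpoly K[n]}) -> m = m1 \/ m = m2.
Proof.
by move/msuppB_le; rewrite mem_cat !msuppX !inE => /orP[] /eqP; [left|right].
Qed.

Lemma initial_binomial (K : fieldType) n lt (m1 m2 : 'X_{1..n}) :
  monomial_order lt -> lt m2 m1 ->
  initial_monomial lt ('X_[m1] - 'X_[m2] : {mpoly K[n]}) m1.
Proof.
move=> mo lt21; have ne := mo_neq mo lt21; split.
  by rewrite mcoeff_msupp mcoeffB !mcoeffX eqxx (negPf ne) subr0 oner_neq0.
by move=> m /mem_msupp_binomial[] -> //; rewrite eqxx.
Qed.

(** Were [m] alone in its fiber, the vanishing sum would reduce to the nonzero coefficient of [m].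
    The map [phi] is left abstract to serve both the toric and the Rees ideal. *)
Lemma fiber_mate (K : fieldType) n (T : eqType) (phi : 'X_{1..n} -> T)
    (p : {mpoly K[n]}) m :
  \sum_(m' <- msupp p | phi m' == phi m) p@_m' = 0 -> m \in msupp p ->
  exists m', [/\ m' \in msupp p, m' != m & phi m' = phi m].
Proof.
move=> sum0 mp.
case: (altP (@hasP _ [pred m' | (m' != m) && (phi m' == phi m)] (msupp p))).
  by case=> m' m'p /andP[ne /eqP e]; exists m'.
move/hasPn => no_mate; move: sum0; rewrite (big_rem m) //= eqxx big_seq_cond.
rewrite big1 => [/eqP|m' /andP[]].
  by rewrite addr0 mcoeff_eq0 mp.
rewrite (mem_rem_uniq _ (msupp_uniq p)) inE /= => /andP[ne /no_mate] /=.
by rewrite ne /= => /negPf ->.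
Qed.

(** Since [A] is a mere proposition, excluded middle decides for each entry of [s] whether to keep
    it. *)
Lemma finite_subsetS (K : fieldType) n (A : {mpoly K[n]} -> Prop)
    (s : seq {mpoly K[n]}) :
  (forall p, A p -> p \in s) -> finite_subset A.
Proof.
elim: s A => [|x s IHs] A sAs; first by exists [::] => p; split=> // /sAs.
have [|t At] := IHs (fun p => A p /\ p != x).
  by move=> p [/sAs]; rewrite inE => /predU1P[->|//]; rewrite eqxx.
case: (classic (A x)) => Ax.
  exists (x :: t) => p; rewrite inE.
  have [->|ne] := eqVneq p x; first by [].
  by split=> [Ap|/(At p).2 []//]; apply/(At p).1.
exists t => p; split=> [Ap|/(At p).2 []//].
by apply/(At p).1; split=> //; apply/negP => /eqP px; apply: Ax; rewrite -px.
Qed.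

(** * The toric ideal of [K[B]]: fibers, standard monomials and the elements of [G] *)

(** The exponent of the monomial [u^a] of S. *)
Definition Bprod n b (B : b.-tuple 'X_{1..n}) (a : 'X_{1..b}) : 'X_{1..n} :=
  (\sum_(k < b) tnth B k *+ a k)%MM.

Lemma BprodD n b (B : b.-tuple 'X_{1..n}) a1 a2 :
  Bprod B (a1 + a2) = (Bprod B a1 + Bprod B a2)%MM.
Proof.
apply/mnmP => i; rewrite mnmDE !mnm_sumE -big_split /=.
by apply: eq_bigr => k _; rewrite !mulmnE mnmDE mulnDr.
Qed.

Lemma Bprod0 n b (B : b.-tuple 'X_{1..n}) : Bprod B 0%MM = 0%MM.
Proof. by apply: big1 => k _; rewrite mnm0E. Qed.

Lemma BprodU n b (B : b.-tuple 'X_{1..n}) k : Bprod B U_(k)%MM = tnth B k.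
Proof.
rewrite /Bprod (bigD1 k) //= mnm1E eqxx mulm1n big1 ?addm0 // => l ne.
by rewrite mnm1E eq_sym (negPf ne).
Qed.

Lemma Bprod_sum n b (B : b.-tuple 'X_{1..n}) N (u : 'I_N -> 'I_b) :
  Bprod B (\sum_(e < N) U_(u e))%MM = (\sum_(e < N) tnth B (u e))%MM.
Proof.
rewrite (big_morph _ (BprodD B) (Bprod0 B)).
by apply: eq_bigr => e _; rewrite BprodU.
Qed.

Lemma mdeg_Bprod n b (B : b.-tuple 'X_{1..n}) d a :
  (forall k, mdeg (tnth B k) = d) -> mdeg (Bprod B a) = (d * mdeg a)%N.
Proof.
move=> degB; rewrite mdeg_sum (mdegE a) big_distrr /=.
by apply: eq_bigr => k _; rewrite mdegMn degB.
Qed.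

(** Passes from exponent vectors to the indexed products of variables in which [sigma_exchange] is
    phrased. *)
Lemma mnm_sum_vars b (a : 'X_{1..b}) N :
  mdeg a = N -> exists u : 'I_N -> 'I_b, a = (\sum_(e < N) U_(u e))%MM.
Proof.
move=> <-; rewrite -size_m2s; exists (tnth (in_tuple (m2s a))).
apply/mnmP => i; rewrite -{1}(s2mK a) mnmE mnm_sumE.
rewrite -sum1_count big_mkcond /= (big_tnth _ _ (m2s a)) /=.
by apply: eq_bigr => e _; rewrite mnm1E; case: (_ == i).
Qed.

Lemma mmap1_Bprod (K : fieldType) n b (B : b.-tuple 'X_{1..n}) a :
  mmap1 (fun k => 'X_[tnth B k]) a = 'X_[Bprod B a] :> {mpoly K[n]}.
Proof.
rewrite /mmap1 (big_morph _ (@mpolyXD n K) (@mpolyX0 n K)).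
by apply: eq_bigr => k _; rewrite mpolyXn.
Qed.

(** The coefficient of [u^a] in the image of [p] is the sum of the coefficients of [p] over the
    fiber of [a]. *)
Lemma toric_mate (K : fieldType) n b (B : b.-tuple 'X_{1..n}) p a :
  toric_ideal K B p -> a \in msupp p ->
  exists a', [/\ a' \in msupp p, a' != a & Bprod B a' = Bprod B a].
Proof.
rewrite /toric_ideal /mmap => /(congr1 (mcoeff (Bprod B a))) sum0.
apply: fiber_mate.
rewrite -[RHS](mcoeff0 K (Bprod B a)) -sum0 raddf_sum big_mkcond /=.
apply: eq_bigr => a' _; rewrite mmap1_Bprod mcoeffCM mcoeffX.
by case: eqP; rewrite ?mulr1 ?mulr0.
Qed.

Lemma toric_binomial (K : fieldType) n b (B : b.-tuple 'X_{1..n}) a1 a2 :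
  Bprod B a1 = Bprod B a2 -> toric_ideal K B ('X_[a1] - 'X_[a2]).
Proof. by move=> e; rewrite /toric_ideal mmapB !mmapX !mmap1_Bprod e subrr. Qed.

(** A smaller [a'] in the fiber gives a binomial of the toric ideal with initial monomial [a].
    Conversely, if the initial monomial [a0] of some [f] divides [a], replacing [a0] in [a] by its
    mate in [f] gives a smaller element of the fiber. *)
Lemma standard_toricP (K : fieldType) n b (B : b.-tuple 'X_{1..n}) lt a :
  monomial_order lt ->
  standard_monomial lt (toric_ideal K B) a <->
  forall a', Bprod B a' = Bprod B a -> a' != a -> lt a a'.
Proof.
move=> mo; split=> [sta a' ea ne|mina].
  case/orP: (mo_total mo ne) => // lta'; case: sta.
  apply/initial_idealXP; exists ('X_[a] - 'X_[a']), a.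
  by split; [apply: toric_binomial|apply: initial_binomial|apply: lepm_refl].
case/initial_idealXP => f [a0 [Jf [a0f maxa0] le]].
have [a1 [a1f ne e]] := toric_mate Jf a0f.
have lt10 := mo_add mo (a - a0)%MM (maxa0 _ a1f ne).
have eB : Bprod B (a1 + (a - a0))%MM = Bprod B a.
  by rewrite -[in RHS](submK le) BprodD e -BprodD addmC.
rewrite [X in lt _ X]addmC submK // in lt10.
by have := mo_asym mo lt10; rewrite mina // (mo_neq mo).
Qed.

Lemma standard_toric_inj (K : fieldType) n b (B : b.-tuple 'X_{1..n}) lt a1 a2 :
  monomial_order lt ->
  standard_monomial lt (toric_ideal K B) a1 ->
  standard_monomial lt (toric_ideal K B) a2 ->
  Bprod B a1 = Bprod B a2 -> a1 = a2.
Proof.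
move=> mo /(standard_toricP K B _ mo) st1 /(standard_toricP K B _ mo) st2 e.
have [//|ne] := eqVneq a1 a2.
by have := mo_asym mo (st2 _ e ne); rewrite st1 // eq_sym.
Qed.

Lemma standard_toric_repr (K : fieldType) n b (B : b.-tuple 'X_{1..n}) d lt a :
  monomial_order lt -> (0 < d)%N -> (forall k, mdeg (tnth B k) = d) ->
  exists a', [/\ standard_monomial lt (toric_ideal K B) a',
    Bprod B a' = Bprod B a & a' = a \/ lt a' a].
Proof.
move=> mo d_gt0 degB.
have deg_fiber a1 a2 : Bprod B a1 = Bprod B a2 -> mdeg a1 = mdeg a2.
  move/(congr1 mdeg); rewrite !(mdeg_Bprod _ degB) => /eqP.
  by rewrite eqn_pmul2l // => /eqP.
(* All of [B] having degree [d > 0], the fiber lies in a single degree, so monomials of degree below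
   [(mdeg a).+1] exhaust it. *)
pose s := [seq x <- [seq val m | m : 'X_{1..b < (mdeg a).+1}] | Bprod B x == Bprod B a].
have in_s x : (x \in s) = (Bprod B x == Bprod B a).
  rewrite mem_filter; case: eqP => //= /deg_fiber e.
  have lt_x : (mdeg x < (mdeg a).+1)%N by rewrite e.
  by apply/mapP; exists (BMultinom lt_x); rewrite ?mem_enum.
have [|x xs minx] := @mo_min _ lt s a mo; first by rewrite in_s.
rewrite in_s in xs; exists x; split; first 1 last.
- exact/eqP.
- have [->|ne] := eqVneq a x; first by left.
  by right; apply: minx; rewrite ?in_s.
apply/standard_toricP => // a' e; apply: minx.
by rewrite in_s e.
Qed.

(** Let [a'] be the standard monomial in the fiber of [a]. Then [g - (X^a - X^a')] lies in the toric
    ideal and has only standard monomials; if nonzero, it would contain two distinct ones in one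
    fiber. *)
Lemma reduced_toric_binomial (K : fieldType) n b (B : b.-tuple 'X_{1..n}) d lt G
    g a :
  monomial_order lt -> (0 < d)%N -> (forall k, mdeg (tnth B k) = d) ->
  reduced_groebner_basis lt (toric_ideal K B) G -> G g ->
  initial_monomial lt g a ->
  exists a', [/\ a != a', Bprod B a = Bprod B a' & g = 'X_[a] - 'X_[a']].
Proof.
move=> mo d_gt0 degB [[_ GJ inG] monG redG] Gg ga.
have [a' [st' e _]] := standard_toric_repr K a mo d_gt0 degB.
have ne : a != a'.
  apply/negP => /eqP aa'; apply: st'; apply/initial_idealXP.
  by exists g, a; split; rewrite -?aa' ?lepm_refl //; case: (GJ _ Gg).
exists a'; split=> //; apply/eqP; rewrite -subr_eq0.
set h := g - _; apply/eqP/msuppnil0.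
(* The monomial [a] cancels because [g] is monic. A monomial other than [a'] comes from [g]:
   reducedness excludes division by the initial monomial of another element of [G], and the order
   excludes division by [a]. *)
have st_h m : m \in msupp h -> standard_monomial lt (toric_ideal K B) m.
  move=> mh; have ma : m != a.
    apply: contraTneq mh => ->; rewrite -mcoeff_eq0 !mcoeffB !mcoeffX eqxx.
    by rewrite [a' == a]eq_sym (negPf ne) (monG _ _ Gg ga) subr0 subrr.
  have [->//|ma'] := eqVneq m a'.
  have mg : m \in msupp g.
    move: mh; rewrite !mcoeff_msupp !mcoeffB !mcoeffX.
    by rewrite ![_ == m]eq_sym (negPf ma) (negPf ma') !subr0.
  move/inG/initial_idealXP => [f [mf [Gf fmf le]]].
  have [fg|fg] := eqVneq f g; last first.
    by move: (redG _ _ _ _ Gf Gg fg fmf mg); rewrite le.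
  move: fmf; rewrite fg => /(initial_uniq mo ga) amf; rewrite -amf in le.
  by move: (mo_lem mo le); rewrite (proj2 ga).
have Jh : toric_ideal K B h.
  have [Jg _] := GJ _ Gg.
  by rewrite /toric_ideal mmapB Jg (toric_binomial K (esym e)) subr0.
case E: (msupp h) => [//|m s].
have mh : m \in msupp h by rewrite E mem_head.
have [m' [m'h /eqP ne' em']] := toric_mate Jh mh.
by case: ne'; apply: (standard_toric_inj mo (st_h _ m'h) (st_h _ mh)).
Qed.

(** * Monomials in the variables x and T, and the product order *)

Definition mjoin n b (c : 'X_{1..n}) (a : 'X_{1..b}) : 'X_{1..n + b} :=
  [multinom match split i with inl j => c j | inr k => a k end | i < n + b].

Lemma xpartK n b c a : xpart (@mjoin n b c a) = c.
Proof.
by apply/mnmP => i; rewrite !mnmE -[lshift b i]/(unsplit (inl i)) unsplitK.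
Qed.

Lemma TpartK n b c a : Tpart (@mjoin n b c a) = a.
Proof.
by apply/mnmP => i; rewrite !mnmE -[rshift n i]/(unsplit (inr i)) unsplitK.
Qed.

Lemma part_inj n b (m1 m2 : 'X_{1..n + b}) :
  xpart m1 = xpart m2 -> Tpart m1 = Tpart m2 -> m1 = m2.
Proof.
move=> /mnmP ex /mnmP eT; apply/mnmP => i; rewrite -(splitK i).
by case: (split i) => j /=; [have := ex j|have := eT j]; rewrite !mnmE.
Qed.

Lemma xpartD n b (m1 m2 : 'X_{1..n + b}) :
  xpart (m1 + m2) = (xpart m1 + xpart m2)%MM.
Proof. by apply/mnmP => i; rewrite !mnmE. Qed.

Lemma TpartD n b (m1 m2 : 'X_{1..n + b}) :
  Tpart (m1 + m2) = (Tpart m1 + Tpart m2)%MM.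
Proof. by apply/mnmP => i; rewrite !mnmE. Qed.

Lemma xpart0 n b : xpart (0%MM : 'X_{1..n + b}) = 0%MM.
Proof. by apply/mnmP => i; rewrite !mnmE. Qed.

Lemma Tpart0 n b : Tpart (0%MM : 'X_{1..n + b}) = 0%MM.
Proof. by apply/mnmP => i; rewrite !mnmE. Qed.

Lemma lem_part n b (m1 m2 : 'X_{1..n + b}) :
  (m1 <= m2)%MM = (xpart m1 <= xpart m2)%MM && (Tpart m1 <= Tpart m2)%MM.
Proof.
apply/mnm_lepP/andP => [le|[/mnm_lepP lex /mnm_lepP leT] i].
  by split; apply/mnm_lepP => i; rewrite !mnmE.
by rewrite -(splitK i); case: (split i) => j /=; [have := lex j|have := leT j];
   rewrite !mnmE.
Qed.

Lemma product_orderP n b (ltS : rel 'X_{1..n}) (ltR : rel 'X_{1..b}) :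
  monomial_order ltS -> monomial_order ltR ->
  monomial_order (product_order ltS ltR).
Proof.
move=> moS moR; split.
- by move=> m; rewrite /product_order (mo_irr moS) (mo_irr moR) andbF.
- move=> m2 m1 m3 /orP[lt12|/andP[/eqP e12 lt12]] /orP[lt23|/andP[/eqP e23 lt23]];
    rewrite /product_order.
  + by rewrite (mo_trans moS lt12 lt23).
  + by rewrite -e23 lt12.
  + by rewrite e12 lt23.
  + by rewrite e12 e23 eqxx (mo_trans moR lt12 lt23) orbT.
- move=> m1 m2 ne; rewrite /product_order.
  have [ex|nex] := eqVneq (xpart m1) (xpart m2).
    rewrite ex (mo_irr moS) /=; apply: mo_total moR _ _ _.
    by apply: contra_neq ne; apply: part_inj.
  by rewrite !orbF mo_total.
- move=> m nz; rewrite /product_order xpart0 Tpart0.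
  have [x0|nx] := eqVneq 0%MM (xpart m).
    apply/orP; right; apply: mo_gt0 => //.
    by apply: contra_neq nz => T0; apply: part_inj; rewrite ?xpart0 ?Tpart0.
  by rewrite mo_gt0 // eq_sym.
move=> m m1 m2 /orP[lt12|/andP[/eqP e lt12]];
  rewrite /product_order !xpartD !TpartD.
  by rewrite mo_add.
by rewrite e eqxx (mo_add moR) ?orbT.
Qed.

(** * The Rees ideal and the embedding of R *)

Lemma mmap1_rees_var (K : fieldType) n b (B : b.-tuple 'X_{1..n}) m :
  mmap1 (rees_var K B) m =
  ('X_[(xpart m + Bprod B (Tpart m))] : {mpoly K[n]})%:P * 'X^(mdeg (Tpart m)).
Proof.
rewrite /mmap1 big_split_ord /= mpolyXD polyCM -mulrA; congr (_ * _).
  rewrite [in RHS]mpolyXE_id rmorph_prod; apply: eq_bigr => i _ /=.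
  rewrite /rees_var -[lshift b i]/(unsplit (inl i)) unsplitK rmorphXn mnmE.
  by [].
rewrite (big_morph _ (@mpolyXD n K) (@mpolyX0 n K)) rmorph_prod.
rewrite mdegE -prodrXr -big_split /=; apply: eq_bigr => k _.
rewrite /rees_var -[rshift n k]/(unsplit (inr k)) unsplitK exprMn !mnmE.
by rewrite -mpolyXn rmorphXn.
Qed.

Lemma rees_mate (K : fieldType) n b (B : b.-tuple 'X_{1..n}) p m :
  rees_toric_ideal K B p -> m \in msupp p ->
  exists m', [/\ m' \in msupp p, m' != m,
    (xpart m' + Bprod B (Tpart m') = xpart m + Bprod B (Tpart m))%MM &
    mdeg (Tpart m') = mdeg (Tpart m)].
Proof.
pose phi (x : 'X_{1..n + b}) := ((xpart x + Bprod B (Tpart x))%MM, mdeg (Tpart x)).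
rewrite /rees_toric_ideal /mmap => Pp mp.
have [|m' [m'p ne e]] := @fiber_mate _ _ _ phi p m _ mp; last first.
  by exists m'; split=> //; [exact: (congr1 fst e)|exact: (congr1 snd e)].
(* First the coefficient of the power of [t], then that of the monomial of S. *)
move/(congr1 (fun q : {poly {mpoly K[n]}} => q`_(phi m).2@_(phi m).1)): Pp.
rewrite coef0 mcoeff0 => sum0; rewrite -[RHS]sum0 coef_sum raddf_sum big_mkcond /=.
apply: eq_bigr => m' _; rewrite mmap1_rees_var /=.
rewrite !coefCM coefXn mulr_natr mcoeffCM mcoeffMn mcoeffX.
rewrite /phi xpair_eqE [_ == mdeg (Tpart m')]eq_sym.
by do 2![case: (_ == _)]; rewrite /= ?mulr0n ?mulr0 ?mulr1n ?mulr1.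
Qed.

Lemma rees_binomial (K : fieldType) n b (B : b.-tuple 'X_{1..n}) m1 m2 :
  (xpart m1 + Bprod B (Tpart m1) = xpart m2 + Bprod B (Tpart m2))%MM ->
  mdeg (Tpart m1) = mdeg (Tpart m2) ->
  rees_toric_ideal K B ('X_[m1] - 'X_[m2]).
Proof.
move=> e1 e2; rewrite /rees_toric_ideal raddfB /= !mmapX !mmap1_rees_var.
by rewrite e1 e2 subrr.
Qed.

Lemma mmap1_Tvar (K : fieldType) n b (a : 'X_{1..b}) :
  mmap1 (@Tvar K n b) a = 'X_[mjoin 0 a].
Proof.
rewrite /mmap1 mpolyXE_id big_split_ord /=.
rewrite [X in _ = X * _]big1 ?mul1r => [|i _].
  by apply: eq_bigr => k _; rewrite mnmE -[rshift n k]/(unsplit (inr k)) unsplitK.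
by rewrite mnmE -[lshift b i]/(unsplit (inl i)) unsplitK mnm0E.
Qed.

Lemma R_in_TX (K : fieldType) n b (a : 'X_{1..b}) :
  R_in_T n ('X_[a] : {mpoly K[b]}) = 'X_[mjoin 0 a].
Proof. by rewrite /R_in_T mmapX mmap1_Tvar. Qed.

Lemma mcoeff_R_in_T (K : fieldType) n b (f : {mpoly K[b]}) m :
  (R_in_T n f)@_m = if xpart m == 0%MM then f@_(Tpart m) else 0.
Proof.
rewrite /R_in_T /mmap raddf_sum /=; case: eqP => [x0|nx].
  rewrite [in RHS](mpolyE f) [RHS]raddf_sum /=; apply: eq_bigr => a _.
  rewrite mmap1_Tvar mcoeffCM mcoeffZ !mcoeffX.
  congr (_ * (nat_of_bool _)%:R).
  apply/eqP/eqP => [<-|->]; first by rewrite TpartK.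
  by apply: part_inj; rewrite ?xpartK ?TpartK.
apply: big1 => a _; rewrite mmap1_Tvar mcoeffCM mcoeffX.
case: eqP => [e|_]; last by rewrite mulr0.
by case: nx; rewrite -e xpartK.
Qed.

Lemma msupp_R_in_T (K : fieldType) n b (f : {mpoly K[b]}) m :
  (m \in msupp (R_in_T n f)) = (xpart m == 0%MM) && (Tpart m \in msupp f).
Proof. by rewrite !mcoeff_msupp mcoeff_R_in_T; case: ifP; rewrite ?eqxx. Qed.

(** On monomials free of x-variables the product order restricts to [ltR]. *)
Lemma initial_R_in_T (K : fieldType) n b (ltS : rel 'X_{1..n})
    (ltR : rel 'X_{1..b}) (f : {mpoly K[b]}) m :
  monomial_order ltS ->
  initial_monomial (product_order ltS ltR) (R_in_T n f) m <->
  xpart m = 0%MM /\ initial_monomial ltR f (Tpart m).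
Proof.
move=> moS; split=> [[]|[x0 [Tf maxT]]].
  rewrite msupp_R_in_T => /andP[/eqP x0 Tf] max; split=> //; split=> // a af ne.
  have := max (mjoin 0 a); rewrite msupp_R_in_T /product_order xpartK TpartK.
  rewrite x0 eqxx af (mo_irr moS) /=; apply=> //.
  by apply: contra_neq ne => <-; rewrite TpartK.
split; first by rewrite msupp_R_in_T x0 eqxx.
move=> m'; rewrite msupp_R_in_T => /andP[/eqP x0' Tf'] ne.
rewrite /product_order x0 x0' eqxx maxT ?orbT //.
by apply: contra_neq ne => e; apply: part_inj; rewrite ?x0.
Qed.

(** * Degrees of the minimal generators *)

(** Some [m0] of degree [d] divides [m], and some [m1] of [M] divides [m0]. If [m1] differs from
    [m], then [m] is redundant, against minimality; hence [m0] equals [m]. *)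
Lemma minimal_generators_mdeg (K : fieldType) n d (I : {mpoly K[n]} -> Prop)
    (M : 'X_{1..n} -> Prop) m :
  monomial_ideal_generated_in_degree d I -> minimal_monomial_generators M I ->
  M m -> mdeg m = d.
Proof.
move=> [M0 degM0 genM0] [genM minM] Mm.
have dom M1 M2 x : monomials_generate M1 I -> monomials_generate M2 I -> M1 x ->
    exists2 y, M2 y & (y <= x)%MM.
  move=> gen1 gen2 M1x; apply: (@mem_ideal_genX K n M2 'X_[x]).
    by apply/gen2/gen1/(@ideal_genX _ _ _ x); rewrite ?lepm_refl //; exists x.
  by rewrite msuppX mem_head.
have [m0 M0m0 le0] := dom _ _ _ genM genM0 Mm.
have [m1 Mm1 le1] := dom _ _ _ genM0 genM M0m0.
have [e|ne] := eqVneq m1 m.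
  rewrite -(degM0 _ M0m0); congr mdeg; apply/mnmP => i; apply/eqP.
  by rewrite eqn_leq (mnm_lepP le0) -e (mnm_lepP le1).
suff genM' : monomials_generate (fun x => M x /\ x != m) I.
  have [|_] := minM _ _ genM' m Mm; first by move=> x [].
  by rewrite eqxx.
move=> p; split=> [/genM|]; last first.
  move=> Mp; apply/genM; apply: ideal_gen_sub Mp => q [x [Mx _] ->].
  by apply: (@ideal_genX _ _ _ x); rewrite ?lepm_refl //; exists x.
apply: ideal_gen_sub => q [x Mx ->].
have [->|nx] := eqVneq x m.
  apply: (@ideal_genX _ _ _ m1); first by exists m1.
  by apply/mnm_lepP => i; apply: leq_trans (mnm_lepP le1 i) (mnm_lepP le0 i).
by apply: (@ideal_genX _ _ _ x); rewrite ?lepm_refl //; exists x.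
Qed.

(** * Exchange binomials *)

Lemma xvar_Tvar (K : fieldType) n b (i : 'I_n) (k : 'I_b) :
  @xvar K n b i * Tvar K n k = 'X_[mjoin U_(i) U_(k)].
Proof.
rewrite /xvar /Tvar -mpolyXD; congr mpolyX; apply: part_inj.
  rewrite xpartK; apply/mnmP => j.
  by rewrite !mnmE eq_lshift eq_rlshift addn0.
rewrite TpartK; apply/mnmP => j.
by rewrite !mnmE eq_lrshift eq_rshift.
Qed.

(** The x-parts alone decide which term is initial. The relation between the two images is read off
    from the mate of the initial monomial, which can only be the other term. *)
Lemma exchange_initial (K : fieldType) n b (B : b.-tuple 'X_{1..n})
    (ltS : rel 'X_{1..n}) (ltR : rel 'X_{1..b}) (g : {mpoly K[n + b]}) :
  monomial_order ltS -> monomial_order ltR -> exchange_binomial B ltS g ->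
  exists i j k l,
    [/\ g = 'X_[mjoin U_(i) U_(k)] - 'X_[mjoin U_(j) U_(l)],
      initial_monomial (product_order ltS ltR) g (mjoin U_(i) U_(k)),
      (U_(i) + tnth B k = U_(j) + tnth B l)%MM &
      smallest_exchange B ltS (tnth B k) i j].
Proof.
move=> moS moR [i [j [k [l [-> Pg small]]]]]; exists i, j, k, l.
have [ltji _ _] := small; move: Pg; rewrite !xvar_Tvar => Pg.
have ini : initial_monomial (product_order ltS ltR)
    ('X_[mjoin U_(i) U_(k)] - 'X_[mjoin U_(j) U_(l)] : {mpoly K[n + b]})
    (mjoin U_(i) U_(k)).
  by apply: initial_binomial; rewrite /product_order ?xpartK ?ltji //;
     apply: product_orderP.
split=> //; have [m' [m'g ne e _]] := rees_mate Pg (proj1 ini).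
move: ne e; have [->|->] := mem_msupp_binomial m'g; first by rewrite eqxx.
by rewrite !xpartK !TpartK !BprodU.
Qed.

Lemma exchange_binomialI (K : fieldType) n b (B : b.-tuple 'X_{1..n})
    (ltS : rel 'X_{1..n}) i j k l :
  (U_(i) + tnth B k = U_(j) + tnth B l)%MM ->
  smallest_exchange B ltS (tnth B k) i j ->
  exchange_binomial B ltS (xvar K b i * Tvar K n k - xvar K b j * Tvar K n l).
Proof.
move=> eB small; exists i, j, k, l; split; [by [] | | exact: small].
rewrite !xvar_Tvar; apply: rees_binomial; last by rewrite !TpartK !mdeg1.
by rewrite !xpartK !TpartK !BprodU.
Qed.

Lemma smallest_exchange_exists n b (B : b.-tuple 'X_{1..n})
    (ltS : rel 'X_{1..n}) u i j :
  monomial_order ltS -> ltS U_(j)%MM U_(i)%MM -> exchange_in B u i j ->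
  exists j', smallest_exchange B ltS u i j'.
Proof.
move=> mo ltji exj.
pose P := [pred j : 'I_n | ltS U_(j)%MM U_(i)%MM && exchange_in B u i j].
have [|x /mapP[j' + ->] minx] :=
  @mo_min n ltS [seq U_(x)%MM | x <- enum P] U_(j)%MM mo.
  by apply: map_f; rewrite mem_enum inE ltji.
rewrite mem_enum inE => /andP[lt ex]; exists j'; split=> // y lty exy ne.
by apply: minx; rewrite ?eq_mnm1 // map_f // mem_enum inE lty.
Qed.

(** * Initial monomials of the Rees ideal and the reduced basis *)

Lemma rees_initial_divisor (K : fieldType) n b (B : b.-tuple 'X_{1..n}) d
    (ltS : rel 'X_{1..n}) (ltR : rel 'X_{1..b}) (G : {mpoly K[b]} -> Prop) p m :
  monomial_order ltS -> monomial_order ltR -> (0 < d)%N ->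
  (forall k, mdeg (tnth B k) = d) ->
  reduced_groebner_basis ltR (toric_ideal K B) G ->
  sigma_exchange K B ltS ltR ->
  rees_toric_ideal K B p -> initial_monomial (product_order ltS ltR) p m ->
  exists g m0,
    [/\ (exists f : {mpoly K[b]}, G f /\ binomial_poly f /\ g = R_in_T n f) \/
        exchange_binomial B ltS g,
      initial_monomial (product_order ltS ltR) g m0 & (m0 <= m)%MM].
Proof.
move=> moS moR d_gt0 degB redG exB Pp [mp max_m].
(* If the T-part is not standard, the initial monomial of an element of [G] already divides it. *)
case: (classic (standard_monomial ltR (toric_ideal K B) (Tpart m))); last first.
  have [[_ _ inG] _ _] := redG; move/NNPP/inG/initial_idealXP => [f [a [Gf fa le]]].
  have [a' [ne _ ef]] := reduced_toric_binomial moR d_gt0 degB redG Gf fa.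
  exists (R_in_T n f), (mjoin 0 a); split.
  - by left; exists f; split=> //; split=> //; exists a, a'.
  - by apply/initial_R_in_T; rewrite // xpartK TpartK.
  by rewrite lem_part xpartK TpartK le andbT; apply/mnm_lepP => i; rewrite mnm0E.
move=> st_m; have [m' [m'p ne e deg']] := rees_mate Pp mp.
(* Equal x-parts would put both T-parts in one fiber, where the standard [Tpart m] is the least. *)
have ltx : ltS (xpart m') (xpart m).
  case/orP: (max_m _ m'p ne) => // /andP[/eqP ex ltT].
  rewrite ex in e; have eB := addmI e.
  have := (standard_toricP K B _ moR).1 st_m _ eB (mo_neq moR ltT).
  by move/(mo_asym moR)/negP.
have [a [st_a ea _]] := standard_toric_repr K (Tpart m') moR d_gt0 degB.
rewrite -ea in e.
(* The exchange property compares products with equally many factors; equality of the exponents of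
   [t] provides this. *)
have deg_a : mdeg a = mdeg (Tpart m).
  have /eqP := congr1 mdeg ea; rewrite !(mdeg_Bprod _ degB) eqn_pmul2l //.
  by rewrite deg' => /eqP.
have ltB : ltS (Bprod B (Tpart m)) (Bprod B a).
  have lt1 := mo_add moS (Bprod B a) ltx.
  rewrite e ![(xpart m + _)%MM]addmC in lt1.
  exact: mo_addI moS lt1.
have [u eu] := mnm_sum_vars (erefl (mdeg (Tpart m))).
have [v ev] := mnm_sum_vars deg_a.
rewrite eu in st_m; rewrite ev in st_a.
have := exB _ u v st_m st_a; rewrite -!Bprod_sum -eu -ev.
case/(_ ltB) => [delta [q [j [_ _ ltq ltjq exq]]]].
(* Passing to the smallest admissible variable changes only the second term of the binomial. *)
have [j' small] := smallest_exchange_exists moS ltjq exq.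
have [ltj' /andP[lej' /tnthP[l el]] _] := small.
have eBl : (U_(q) + tnth B (u delta) = U_(j') + tnth B l)%MM.
  by rewrite -el [RHS]addmC submK.
exists (xvar K b q * Tvar K n (u delta) - xvar K b j' * Tvar K n l).
exists (mjoin U_(q) U_(u delta)); split.
- by right; apply: exchange_binomialI eBl small.
- rewrite !xvar_Tvar; apply: initial_binomial; first exact: product_orderP.
  by rewrite /product_order !xpartK ltj'.
rewrite lem_part xpartK TpartK; apply/andP; split.
  (* If [q] had exponent 0 in [xpart m], equality of the images would give [u^(Tpart m)] at least
     the exponent of [u^a] at [q], against [ltq]. *)
  rewrite lep1mP; apply: contraTneq ltq => xq0.
  move/mnmP/(_ q): e; rewrite !mnmDE xq0 add0n => <-.
  by rewrite -leqNgt leq_addl.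
rewrite lep1mP eu mnm_sumE (bigD1 delta) //= mnm1E eqxx.
by rewrite -lt0n.
Qed.

Theorem theorem3p4 (K : fieldType) (n d b : nat) (I : {mpoly K[n]} -> Prop)
    (B : b.-tuple 'X_{1..n})
    (ltR : rel 'X_{1..b}) (ltS : rel 'X_{1..n})
    (G : {mpoly K[b]} -> Prop) :
  (0 < d)%N ->
  monomial_ideal_generated_in_degree d I ->
  uniq B -> minimal_monomial_generators (fun m => m \in B) I ->
  monomial_order ltR -> monomial_order ltS ->
  reduced_groebner_basis ltR (toric_ideal K B) G ->
  sigma_exchange K B ltS ltR ->
  reduced_groebner_basis (product_order ltS ltR) (rees_toric_ideal K B)
    (fun g : {mpoly K[n + b]} =>
       (exists f : {mpoly K[b]}, G f /\ binomial_poly f /\ g = R_in_T n f) \/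
       exchange_binomial B ltS g).
Proof.
move=> d_gt0 degI uB minB moR moS redG exB.
have degB k : mdeg (tnth B k) = d.
  exact: minimal_generators_mdeg degI minB (mem_tnth _ _).
have moP := product_orderP moS moR.
have [[[sG sGP] GJ inG] monG rG] := redG.
(* A variable is alone in its fiber: by degrees the fiber consists of variables, and [B] has no
   repetition. *)
have standardU k : standard_monomial ltR (toric_ideal K B) U_(k)%MM.
  apply/standard_toricP => // a ea /eqP[].
  have /mdeg1P[l /eqP al] : mdeg a == 1%N.
    rewrite -(eqn_pmul2l d_gt0) -(mdeg_Bprod _ degB) ea BprodU degB.
    by rewrite muln1.
  rewrite al; congr mnm1; apply: (tuple_uniqP _ uB).
  by rewrite -!BprodU -al.
have notU a k : (exists2 f, G f & initial_monomial ltR f a) -> ~~ (a <= U_(k))%MM.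
  move=> [f Gf fa]; apply/negP => le; case: (standardU k).
  by apply/initial_idealXP; exists f, a; split=> //; case: (GJ _ Gf).
have ReesP g :
    (exists f : {mpoly K[b]}, G f /\ binomial_poly f /\ g = R_in_T n f) \/
    exchange_binomial B ltS g -> rees_toric_ideal K B g /\ g != 0.
  move=> [[f [Gf [[a [a' [ne ef]]] ->]]]|Eg].
    have [Jf nzf] := GJ _ Gf; split; last first.
      apply: contra_neq nzf => RT0; apply/mpolyP => x.
      have := mcoeff_R_in_T f (mjoin (0 : 'X_{1..n})%MM x).
      by rewrite RT0 xpartK TpartK eqxx !mcoeff0.
    have eB : Bprod B a = Bprod B a'.
      have af : a \in msupp f.
        rewrite ef mcoeff_msupp mcoeffB !mcoeffX eqxx [a' == a]eq_sym.
        by rewrite (negPf ne) subr0 oner_neq0.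
      have [x [xf nx ex]] := toric_mate Jf af.
      by rewrite ef in xf; case: (mem_msupp_binomial xf) => xE;
         [rewrite xE eqxx in nx | rewrite -xE ex].
    rewrite ef /R_in_T mmapB -!/(R_in_T _ _) !R_in_TX.
    apply: rees_binomial; rewrite ?xpartK !TpartK ?eB //.
    (* The exponents of [t] also agree, since [d > 0] can be cancelled from the degrees of the
       images. *)
    have /eqP := congr1 mdeg eB.
    by rewrite !(mdeg_Bprod _ degB) eqn_pmul2l // => /eqP.
  have [i [j [k [l [_ [m0s _] _ _]]]]] := exchange_initial moS moR Eg.
  split; first by case: Eg => [? [? [? [? []]]]].
  by apply: contraTneq m0s => ->; rewrite msupp0.
split.
- split.
  (* Finiteness: exchange binomials are indexed by quadruples of indices. *)
  + pose ex (x : 'I_n * 'I_n * 'I_b * 'I_b) : {mpoly K[n + b]} :=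
      let: (i, j, k, l) := x in
      xvar K b i * Tvar K n k - xvar K b j * Tvar K n l.
    apply: (@finite_subsetS K (n + b) _ (map (@R_in_T K n b) sG ++ codom ex)) => g.
    rewrite mem_cat => -[[f [/sGP fs [_ ->]]]|[i [j [k [l [-> _ _]]]]]].
      by rewrite map_f.
    by apply/orP; right; apply/codomP; exists (i, j, k, l).
  + exact: ReesP.
  + move=> p; split; apply: ideal_gen_sub => q [f [m [Pf fm ->]]];
      apply/initial_idealXP.
      exact: rees_initial_divisor moS moR d_gt0 degB redG exB Pf fm.
    by exists f, m; split; [apply: (proj1 (ReesP _ Pf))|apply: fm|apply: lepm_refl].
- move=> g m [[f [Gf [_ ->]]]|Eg].
    by case/(initial_R_in_T _ _ _ moS) => x0 fT;
       rewrite mcoeff_R_in_T x0 eqxx (monG _ _ Gf fT).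
  have [i [j [k [l [eg ini _ [ltji _ _]]]]]] := exchange_initial moS moR Eg.
  move/(initial_uniq moP ini) <-; rewrite eg mcoeffB !mcoeffX eqxx.
  case: eqP => [/(congr1 (@xpart n b))|_]; last by rewrite subr0.
  by rewrite !xpartK => eU; move: ltji; rewrite eU (mo_irr moS).
(* In the mixed cases, a term of an exchange binomial has a single variable as T-part, which no
   initial monomial from [G] divides; and elements of [G] contain no x-variable. *)
move=> g g' m m' [[f [Gf [_ ->]]]|Eg] [[f' [Gf' [_ ->]]]|Eg'] ne.
- case/(initial_R_in_T _ _ _ moS) => x0 fm.
  rewrite msupp_R_in_T => /andP[_ fm']; rewrite lem_part negb_and orbC.
  rewrite (rG _ _ _ _ Gf Gf' _ fm fm') //.
  by apply: contra_neq ne => ->.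
- case/(initial_R_in_T _ _ _ moS) => x0 fm.
  have [i [j [k [l [eg _ _ _]]]]] := exchange_initial moS moR Eg'.
  rewrite eg => /mem_msupp_binomial m'E; rewrite lem_part negb_and orbC.
  by case: m'E => ->; rewrite TpartK notU //; exists f.
- have [i [j [k [l [eg ini _ _]]]]] := exchange_initial moS moR Eg.
  move/(initial_uniq moP ini) <-; rewrite msupp_R_in_T => /andP[/eqP x0 _].
  by rewrite lem_part xpartK x0 lep1mP mnm0E.
have [i [j [k [l [eg ini eB [ltji exj minj]]]]]] := exchange_initial moS moR Eg.
have [i' [j' [k' [l' [eg' _ eB' [ltji' exj' minj']]]]]] :=
  exchange_initial moS moR Eg'.
move/(initial_uniq moP ini) <-; rewrite eg' => m'g; apply/negP.
have leU N (x y : 'I_N) : (U_(x) <= U_(y))%MM -> x = y.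
  by rewrite lep1mP mnm1E; case: (y =P x).
have [m'E|m'E] := mem_msupp_binomial m'g; rewrite m'E lem_part !xpartK !TpartK;
  case/andP => /leU ei /leU ek; subst.
  (* Equal initial monomials: both [j] and [j'] are smallest for the same exchange, and cancellation
     then gives [l = l'], so the binomials coincide. *)
  have ej : j = j'.
    apply/eqP; apply: contraT => nj.
    have := mo_asym moS (minj _ ltji' exj' _); rewrite minj' ?[j' == j]eq_sym //.
    by move=> /(_ nj).
  subst; case/eqP: ne; congr (_ - 'X_[mjoin _ U_(_)]).
  by apply: (tuple_uniqP _ uB); apply: (@addmI _ U_(j')%MM); rewrite -eB -eB'.
(* Here the initial term of [g] is the second term of [g']. Chaining the two relations makes [x_j]
   admissible for the exchange of [g'], yet it is smaller than the minimal choice [x_j']. *)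
have exj2 : exchange_in B (tnth B k') i' j by move: exj; rewrite /exchange_in -eB'.
have [ejj|nj] := eqVneq j j'; first by move: ltji; rewrite ejj (mo_irr moS).
have := minj' _ (mo_trans moS ltji ltji') exj2 nj.
by move/(mo_asym moS); rewrite ltji.
Qed.
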